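(* Let $G=(V,E)$ be a connected, locally finite graph with vertex weight $\mu:V\to(0,\infty)$, $\mu(x)\ge\mu_{\min}>0$ for all $x$, and let $p>4$. Let $a_0,b_0:V\to\mathbb R$ satisfy: (A1) $a_0(x)\ge V_0$ and $b_0(x)\ge V_0$ for all $x\in V$, for some constant $V_0>0$; (A2') there exists $\mathcal M_0>0$ such that the sets $\{a_0\le\mathcal M_0\}$ and $\{b_0\le\mathcal M_0\}$ have finite volume, $\frac1{a_0}\in L^1(V\setminus\{a_0\le\mathcal M_0\})$ and $\frac1{b_0}\in L^1(V\setminus\{b_0\le\mathcal M_0\})$. Let $(u_0,v_0)$ be a ground state of $J_{a_0,b_0}$. Then there exist constants $\varepsilon_0>0$ and $l>0$ such that for all potentials $a=a_0+\delta a_1$, $b=b_0+\delta b_1$ with $\|\delta a_1\|_\infty,\|\delta b_1\|_\infty\le\varepsilon_0$, the ground-state energy satisfies $$|d(a,b)-d(a_0,b_0)|\le l\max\{\|\delta a_1\|_\infty,\|\delta b_1\|_\infty\},$$ where the constant $l$ depends only on the reference ground state $(u_0,v_0)$ and on $p$, $V_0$. Moreover, with $$\Delta=\int_V(\delta a_1|u_0|^p+\delta b_1|v_0|^p)\,d\mu,\qquad \Delta'=\int_V(\delta a_1|u|^p+\delta b_1|v|^p)\,d\mu,$$ where $(u,v)$ is a ground state of $J_{a,b}$, for $\Delta$ and $\Delta'$ sufficiently small there holds $$d(a_0,b_0)+\tfrac1p\Delta'-O(|\Delta'|^2)\le d(a,b)\le d(a_0,b_0)+\tfrac1p\Delta+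O(|\Delta|^2).$$
   Context: Here $\delta a_1,\delta b_1:V\to\mathbb R$ denote bounded perturbation functions. Notation. $x\sim y$ means $(x,y)\in E$; $\int_V f\,d\mu=\sum_{x\in V}f(x)\mu(x)$; $C_c(V)$: finitely supported functions. $|\nabla u|(x)=\big(\frac1{2\mu(x)}\sum_{y\sim x}(u(y)-u(x))^2\big)^{1/2}$. $W^{1,p}(V)$ is the completion of $C_c(V)$ under $(\int_V(|\nabla u|^p+|u|^p)d\mu)^{1/p}$. For a potential $a$, $\mathcal H_a=\{u\in W^{1,p}(V):\int_Va|u|^pd\mu<\infty\}$ with $\|u\|_{\mathcal H_a}=(\int_V(|\nabla u|^p+a|u|^p)d\mu)^{1/p}$; $\mathcal H=\mathcal H_a\times\mathcal H_b$. Expressions such as $s^2\log s^2$ are $0$ at $s=0$. For potentials $(a,b)$, $$J_{a,b}(u,v)=\tfrac1p\big(\|u\|_{\mathcal H_a}^p+\|v\|_{\mathcal H_b}^p\big)-\tfrac1p\int_V|u|^{p-2}v^2\log v^2\,d\mu-\tfrac1p\int_V|v|^{p-2}u^2\log u^2\,d\mu,$$ $$\mathcal N_{a,b}=\{(u,v)\in\mathcal H\setminus\{(0,0)\}:J_{a,b}'(u,v)\cdot(u,v)=0\},\qquad d(a,b)=\inf_{\mathcal N_{a,b}}J_{a,b}.$$ A ground state of $J_{a,b}$ is $(u,v)\in\mathcal N_{a,b}$ with $J_{a,b}(u,v)=d(a,b)$. $O(|\Delta|^2)$ (resp. $O(|\Delta'|^2)$) denotes a quantity bounded in absolute value by $C|\Delta|^2$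 (resp. $C|\Delta'|^2$) with $C$ independent of the perturbation. *)

(* Defs.v *)
From HB Require Import structures.
From mathcomp Require Import all_boot all_order all_algebra.
From mathcomp Require Import all_classical all_reals all_analysis.

Set Implicit Arguments.
Unset Strict Implicit.
Unset Printing Implicit Defensive.

Import Order.TTheory GRing.Theory Num.Theory.
Import numFieldNormedType.Exports.

Local Open Scope classical_set_scope.
Local Open Scope ring_scope.

Section Graph.
Context {V : choiceType}.
Variable E : rel V.

Definition graph_connected : Prop :=
  forall x y, exists s : seq V, path E x s /\ last x s = y.

Definition locally_finite_graph : Prop :=
  forall x, finite_set [set y | E x y].

End Graph.

Section Functional.
Context {R : realType} {V : choiceType}.
Variables (E : rel V) (mu : V -> R) (p : R).
Implicit Types (u v f a b : V -> R) (D : set V).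

(* \esum is only meaningful for nonnegative families, hence the splitting into
   positive and negative parts. The result is the usual sum when the family is
   absolutely summable, or when at most one of the two parts diverges. *)
Definition eintegralV f : \bar R :=
  let g := fun x => (f x * mu x)%:E in
  (esum setT g^\+ - esum setT g^\-)%E.

(* Real-valued integral, used for absolutely summable families. *)
Definition integralV f : R := fine (eintegralV f).

Definition volume D : \bar R := \esum_(x in D) (mu x)%:E.

Definition L1_on D f : Prop := summable D (fun x => (f x * mu x)%:E).

Definition grad u (x : V) : R :=
  Num.sqrt ((2 * mu x)^-1 * \sum_(y \in [set y | E x y]) (u y - u x) ^+ 2).

Definition Cc f : Prop := finite_set [set x | f x != 0].

Definition W1p_norm u : \bar R :=
  (eintegralV (fun x => (grad u x `^ p + `|u x| `^ p)%R) `^ p^-1)%E.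

(* When mu is bounded below by a positive constant, convergence in the
   W^{1,p} norm implies uniform convergence, and on a locally finite graph
   the norm is lower semicontinuous under pointwise convergence. The abstract
   completion of Cc is therefore the norm closure of Cc inside the space of
   all functions on V. *)
Definition W1p u : Prop :=
  forall e : R, 0 < e ->
    exists2 phi, Cc phi & (W1p_norm (fun x => (u x - phi x)%R) < e%:E)%E.

Definition H_space a u : Prop :=
  W1p u /\ (eintegralV (fun x => (a x * `|u x| `^ p)%R) < +oo)%E.

Definition H_norm a u : R :=
  integralV (fun x => grad u x `^ p + a x * `|u x| `^ p) `^ p^-1.

(* The library's ln is total with ln 0 = 0, so s ^+ 2 * ln (s ^+ 2) vanishes
   at s = 0. *)
Definition J a b u v : R :=
  p^-1 * (H_norm a u `^ p + H_norm b v `^ p)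
  - p^-1 * integralV (fun x => `|u x| `^ (p - 2) * (v x ^+ 2 * ln (v x ^+ 2)))
  - p^-1 * integralV (fun x => `|v x| `^ (p - 2) * (u x ^+ 2 * ln (u x ^+ 2))).

(* J'(u,v).(phi,psi) exists and equals l *)
Definition is_dJ a b u v (phi psi : V -> R) (l : R) : Prop :=
  is_derive (0 : R) (1 : R)
    (fun t : R => J a b (fun x => u x + t * phi x) (fun x => v x + t * psi x))
    l.

Definition Nehari a b : set ((V -> R) * (V -> R)) :=
  [set w | [/\ H_space a w.1, H_space b w.2,
               w <> (cst 0, cst 0) & is_dJ a b w.1 w.2 w.1 w.2 0]].

(* Valued in \bar R: unlike the real-valued inf of the library, ereal_inf has
   no default value on empty or unbounded sets. *)
Definition ground_energy a b : \bar R :=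
  ereal_inf [set (J a b w.1 w.2)%:E | w in Nehari a b].

Definition ground_state a b u v : Prop :=
  Nehari a b (u, v) /\ (J a b u v)%:E = ground_energy a b.

Definition hypA1 (V0 : R) a b : Prop :=
  (forall x, V0 <= a x) /\ (forall x, V0 <= b x).

Definition hypA2' a b : Prop :=
  exists M0 : R,
    [/\ 0 < M0,
        (volume [set x | (a x <= M0)%R] < +oo)%E,
        (volume [set x | (b x <= M0)%R] < +oo)%E,
        L1_on (~` [set x | a x <= M0]) (fun x => (a x)^-1) &
        L1_on (~` [set x | b x <= M0]) (fun x => (b x)^-1)].

Definition supnorm f : R := sup [set `|f x| | x in setT].

End Functional.

(* Main.v *)
(* With A the two norms, B the two logarithmic terms and
   K = int |u|^(p-2) v^2 + int |v|^(p-2) u^2, one has along rays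
     J(tu, tv) = t^p (A - B - 2 K ln t) / p.
   Hence (u, v) lies on the Nehari set iff A - B = 2K/p, where J = 2K/p^2, and
   every ray with K > 0 meets it at energy
     (2K/p^2) exp (p (A - B) / (2K) - 1).
   Replacing (a, b) by (a', b') changes A by
   D = int (a' - a) |u|^p + (b' - b) |v|^p and leaves B and K unchanged, so a
   point of energy j on the old Nehari set yields
     d(a', b') <= j exp (D / (p j)).
   Using this in both directions gives all the estimates, once j is bounded
   below and |u|_p^p + |v|_p^p is bounded by O(j^2) on the Nehari set. *)
Require Import Defs.
From HB Require Import structures.
From mathcomp Require Import all_boot all_order all_algebra.
From mathcomp Require Import all_classical all_reals all_analysis.
From mathcomp Require Import finmap ring lra.

Set Implicit Arguments.
Unset Strict Implicit.
Unset Printing Implicit Defensive.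

Import Order.TTheory GRing.Theory Num.Theory.
Import numFieldNormedType.Exports.

Local Open Scope classical_set_scope.
Local Open Scope ring_scope.

(** * Summable functions on V *)

Section Integral.
Context {R : realType} {V : choiceType} (mu : V -> R).
Hypothesis mu_gt0 : forall x, 0 < mu x.
Implicit Types (f g h : V -> R).

(** The integrals in [J] are made real by [fine], so the ray formula can only be trusted when the
    logarithmic terms are summable. This is where (A2') enters: it makes |u|^(p-1) summable, which
    controls s^2 |ln s^2| for small s. The other difficulty is uniformity. In j exp(D / (p j)) the
    first-order term D / p yields Delta / p, and the quadratic error, of order D^2 / (p^2 j), is
    uniform because j is bounded below. For the linear estimate, a perturbation of size M gives |D|
    <= M L j^2, so the exponent is only bounded by M L j / p, while no upper bound on j is available
    on the perturbed Nehari set. Points with j above d(a0, b0) are harmless, however, since they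
    cannot pull d(a, b) below that value. The lower bound thus runs over all points of the perturbed
    Nehari set and does not presuppose that d(a, b) is attained. *)

Definition integrableV f : Prop := summable setT (fun x => (f x * mu x)%:E).

Lemma esumZ (a : V -> \bar R) (D : set V) (c : R) : 0 <= c ->
  (forall x, 0%E <= a x)%E ->
  (\esum_(x in D) (c%:E * a x) = c%:E * \esum_(x in D) a x)%E.
Proof.
have le_esumZ (k : R) (b : V -> \bar R) : 0 <= k -> (forall x, 0%E <= b x)%E ->
    (\esum_(x in D) (k%:E * b x) <= k%:E * \esum_(x in D) b x)%E.
  move=> k0 b0; apply: ge_ereal_sup => _ [X XD <-].
  rewrite -ge0_mule_fsumr//; apply: lee_pmul => //.
    by rewrite fsume_ge0.
  by apply: ereal_sup_ubound; exists X.
rewrite le_eqVlt => /predU1P[<-|c0] a0.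
  by rewrite mul0e esum1// => x _; rewrite mul0e.
apply/le_anti/andP; split; first exact: le_esumZ (ltW c0) a0.
rewrite -lee_pdivlMl//.
(* The converse is the same inequality for the factor [c^-1] and the family c a. *)
apply: le_trans (le_esumZ c^-1 (fun x => c%:E * a x)%E _ _).
- by apply: le_esum => x _; rewrite muleA -EFinM mulVf ?gt_eqF// mul1e.
- by rewrite invr_ge0 ltW.
- by move=> x; rewrite mule_ge0// lee_fin ltW.
Qed.

Lemma integrableV_le f g : (forall x, `|f x| <= g x) ->
  integrableV g -> integrableV f.
Proof.
move=> fg; apply: le_lt_trans; apply: le_esum => x _.
by rewrite !abse_EFin lee_fin !normrM ler_wpM2r// (le_trans (fg x))// ler_norm.
Qed.

Lemma integrableVN f : integrableV f -> integrableV (fun x => - f x).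
Proof.
by apply: le_lt_trans; apply: le_esum => x _; rewrite mulNr !abse_EFin normrN.
Qed.

Lemma integrableVD f g : integrableV f -> integrableV g ->
  integrableV (fun x => f x + g x).
Proof.
move=> If Ig; have := summableD If Ig; apply: le_lt_trans.
by apply: le_esum => x _; rewrite /= mulrDl.
Qed.

Lemma integrableVZ (c : R) f : integrableV f -> integrableV (fun x => c * f x).
Proof.
rewrite /integrableV /summable => If.
rewrite (eq_esum (b := fun x => (`|c|%:E * `|(f x * mu x)%:E|)%E)); last first.
  by move=> x _; rewrite -mulrA EFinM abseM.
by rewrite esumZ// lte_mul_pinfty// fin_numE.
Qed.

Lemma integrableV_fin_supp f : finite_set [set x | f x != 0] -> integrableV f.
Proof.
move=> suppf; rewrite /integrableV /summable.
rewrite (eq_esum (b := fun x => if x \in [set x | f x != 0]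
    then `|(f x * mu x)%:E|%E else 0%E)); last first.
  move=> x _; case: ifPn => //; rewrite notin_setE/= => /negP.
  by rewrite negbK => /eqP ->; rewrite mul0r normr0.
rewrite -esum_mkcond esum_fset//.
by rewrite fsbig_finite//= sumEFin ltry.
Qed.

Lemma eintegralV_ge0E f : (forall x, 0 <= f x) ->
  eintegralV mu f = (\esum_(x in setT) (f x * mu x)%:E)%E.
Proof.
move=> f0; rewrite /eintegralV [X in (_ - X)%E]esum1 ?sube0.
  apply: eq_esum => x _; rewrite funeposE; apply/max_idPl.
  by rewrite lee_fin mulr_ge0// ltW.
move=> x _; rewrite funenegE; apply/max_idPr.
by rewrite -EFinN lee_fin oppr_le0 mulr_ge0// ltW.
Qed.

Lemma eintegralV_ge0 f : (forall x, 0 <= f x) -> (0%E <= eintegralV mu f)%E.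
Proof.
move=> f0; rewrite eintegralV_ge0E//; apply: esum_ge0 => x _.
by rewrite lee_fin mulr_ge0// ltW.
Qed.

Lemma integralV_ge0 f : (forall x, 0 <= f x) -> 0 <= integralV mu f.
Proof. by move=> f0; rewrite fine_ge0// eintegralV_ge0. Qed.

Lemma eintegralV_lty f : (forall x, 0 <= f x) ->
  (eintegralV mu f < +oo)%E <-> integrableV f.
Proof.
move=> f0; rewrite eintegralV_ge0E// /integrableV /summable.
rewrite (eq_esum (b := fun x => `|(f x * mu x)%:E|)%E)//.
by move=> x _; rewrite gee0_abs// lee_fin mulr_ge0// ltW.
Qed.

Let eintegralV_ge0_fin f : (forall x, 0 <= f x) -> integrableV f ->
  (\esum_(x in setT) (f x * mu x)%:E)%E = (integralV mu f)%:E.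
Proof.
move=> f0 If; rewrite -eintegralV_ge0E// fineK// ge0_fin_numE.
  exact/eintegralV_lty.
exact: eintegralV_ge0.
Qed.

Let integralVD_ge0 f g : (forall x, 0 <= f x) -> (forall x, 0 <= g x) ->
  integrableV f -> integrableV g ->
  integralV mu (fun x => f x + g x) = integralV mu f + integralV mu g.
Proof.
move=> f0 g0 If Ig; apply: EFin_inj; rewrite EFinD.
rewrite -!eintegralV_ge0_fin//; last 2 first.
  by move=> x; rewrite addr_ge0.
  exact: integrableVD.
rewrite -esumD//; last 2 first.
  by move=> x _; rewrite lee_fin mulr_ge0// ltW.
  by move=> x _; rewrite lee_fin mulr_ge0// ltW.
by apply: eq_esum => x _; rewrite mulrDl EFinD.
Qed.

Let integralVB_ge0 f g : (forall x, 0 <= f x) -> (forall x, 0 <= g x) ->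
  integrableV f -> integrableV g ->
  integralV mu (fun x => f x - g x) = integralV mu f - integralV mu g.
Proof.
move=> f0 g0 If Ig; rewrite {1}/integralV /eintegralV.
rewrite (_ : (fun x => ((f x - g x) * mu x)%:E) =
  ((fun x => (f x * mu x)%:E) \- (fun x => (g x * mu x)%:E))%E); last first.
  by apply/funext => x; rewrite mulrBl EFinB.
rewrite (esumB If Ig); last 2 first.
  by move=> x _; rewrite lee_fin mulr_ge0// ltW.
  by move=> x _; rewrite lee_fin mulr_ge0// ltW.
by rewrite !eintegralV_ge0_fin.
Qed.

Lemma integralV_ext f g : f =1 g -> integralV mu f = integralV mu g.
Proof. by move=> /funext ->. Qed.

Let pos f x := Num.max (f x) 0.
Let neg f x := Num.max (- f x) 0.
Let pos0 f x : 0 <= pos f x. Proof. by rewrite /pos le_max lexx orbT. Qed.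
Let neg0 f x : 0 <= neg f x. Proof. by rewrite /neg le_max lexx orbT. Qed.
Let posBneg f x : f x = pos f x - neg f x.
Proof. by rewrite /pos /neg /Num.max; do 2?case: ifP; lra. Qed.
Lemma integrableV_norm f : integrableV f -> integrableV (fun x => `|f x|).
Proof.
apply: le_lt_trans; apply: le_esum => x _.
by rewrite !abse_EFin !normrM normr_id.
Qed.

Let Ipos f : integrableV f -> integrableV (pos f).
Proof.
move=> /integrableV_norm; apply: integrableV_le => x.
rewrite ger0_norm//; rewrite /pos ge_max ler_norm normr_ge0//.
Qed.

Let Ineg f : integrableV f -> integrableV (neg f).
Proof.
move=> /integrableV_norm; apply: integrableV_le => x.
by rewrite ger0_norm// /neg ge_max -normrN ler_norm normr_ge0.
Qed.

Let posBnegE f : integrableV f ->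
  integralV mu f = integralV mu (pos f) - integralV mu (neg f).
Proof.
move=> If; rewrite {1}(integralV_ext (posBneg f)).
exact: (integralVB_ge0 (pos0 f) (neg0 f) (Ipos If) (Ineg If)).
Qed.

(** [integralV] is itself a difference of two sums, so subtraction is the natural first rule: f - g
    = (f^+ + g^-) - (f^- + g^+) reduces it to nonnegative functions. Addition of signed functions is
    then derived from it. *)
Lemma integralVB f g : integrableV f -> integrableV g ->
  integralV mu (fun x => f x - g x) = integralV mu f - integralV mu g.
Proof.
move=> If Ig; rewrite (posBnegE If) (posBnegE Ig).
have -> : integralV mu (fun x => f x - g x) =
    integralV mu (fun x => (pos f x + neg g x) - (neg f x + pos g x)).
  by apply: integralV_ext => x; rewrite (posBneg f) (posBneg g); ring.
have Dfg := integralVD_ge0 (pos0 f) (neg0 g) (Ipos If) (Ineg Ig).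
have Dgf := integralVD_ge0 (neg0 f) (pos0 g) (Ineg If) (Ipos Ig).
rewrite integralVB_ge0 ?Dfg ?Dgf.
- by ring.
- by move=> x; rewrite addr_ge0 ?pos0 ?neg0.
- by move=> x; rewrite addr_ge0 ?pos0 ?neg0.
- by apply: integrableVD; [exact: Ipos|exact: Ineg].
- by apply: integrableVD; [exact: Ineg|exact: Ipos].
Qed.

Lemma integralV0 : integralV mu (fun=> 0) = 0.
Proof.
by rewrite /integralV eintegralV_ge0E// esum1// => x _; rewrite mul0r.
Qed.

Lemma integrableV0 : integrableV (fun=> 0).
Proof.
by rewrite /integrableV /summable esum1// => x _; rewrite mul0r abse_EFin normr0.
Qed.

Lemma integralVN f : integrableV f ->
  integralV mu (fun x => - f x) = - integralV mu f.
Proof.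
move=> If; rewrite (@integralV_ext _ (fun x => 0 - f x)).
  by rewrite integralVB// ?integralV0 ?sub0r//; exact: integrableV0.
by move=> x; rewrite sub0r.
Qed.

Lemma integralVD f g : integrableV f -> integrableV g ->
  integralV mu (fun x => f x + g x) = integralV mu f + integralV mu g.
Proof.
move=> If Ig; rewrite (@integralV_ext _ (fun x => f x - - g x)).
  by rewrite integralVB ?integralVN ?opprK//; exact: integrableVN.
by move=> x; rewrite opprK.
Qed.

Let integralVZ_ge0 (c : R) f : 0 <= c -> (forall x, 0 <= f x) -> integrableV f ->
  integralV mu (fun x => c * f x) = c * integralV mu f.
Proof.
move=> c0 f0 If; apply: EFin_inj; rewrite EFinM.
rewrite -!eintegralV_ge0_fin//; last 2 first.
  by move=> x; rewrite mulr_ge0.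
  exact: integrableVZ.
rewrite -esumZ//.
  by apply: eq_esum => x _; rewrite -mulrA EFinM.
by move=> x; rewrite lee_fin mulr_ge0// ltW.
Qed.

Let integralVZ_nneg (c : R) f : 0 <= c -> integrableV f ->
  integralV mu (fun x => c * f x) = c * integralV mu f.
Proof.
move=> c0 If; have cpos := integrableVZ c (Ipos If).
have cneg := integrableVZ c (Ineg If).
have -> : integralV mu (fun x => c * f x) =
    integralV mu (fun x => c * pos f x - c * neg f x).
  by apply: integralV_ext => x; rewrite {1}(posBneg f) mulrBr.
rewrite (integralVB cpos cneg) (posBnegE If) mulrBr.
by rewrite (integralVZ_ge0 c0 (pos0 f) (Ipos If)) (integralVZ_ge0 c0 (neg0 f) (Ineg If)).
Qed.

Lemma integralVZ (c : R) f : integrableV f ->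
  integralV mu (fun x => c * f x) = c * integralV mu f.
Proof.
move=> If; have [/integralVZ_nneg->//|/ltW c0] := leP 0 c.
rewrite (@integralV_ext _ (fun x => - c * - f x)).
  by rewrite integralVZ_nneg ?oppr_ge0 ?integralVN ?mulrNN//; exact: integrableVN.
by move=> x; rewrite mulrNN.
Qed.

Lemma le_integralV f g : integrableV f -> integrableV g ->
  (forall x, f x <= g x) -> integralV mu f <= integralV mu g.
Proof.
move=> If Ig fg; rewrite -subr_ge0 -integralVB// integralV_ge0// => x.
by rewrite subr_ge0.
Qed.

Lemma term_le_integralV f x : (forall y, 0 <= f y) -> integrableV f ->
  f x * mu x <= integralV mu f.
Proof.
move=> f0 If; rewrite -lee_fin -eintegralV_ge0_fin//.
have fmu0 y : (0 <= (f y * mu y)%:E)%E by rewrite lee_fin mulr_ge0// ltW.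
rewrite -(@esum_set1 _ _ x (fun x => (f x * mu x)%:E) (fmu0 x)) esum_mkcond.
by apply: le_esum => y _; case: ifP.
Qed.

End Integral.

(** * The space W^{1,p} *)

Section PowerInequalities.
Context {R : realType}.
Implicit Types s t p : R.

Lemma ler_powRl p s t : 0 <= p -> 0 <= s -> s <= t -> s `^ p <= t `^ p.
Proof.
by move=> p0 s0 st; apply: ge0_ler_powR; rewrite ?nnegrE// (le_trans s0).
Qed.

Lemma powRD_le p s t : 0 <= p -> 0 <= s -> 0 <= t ->
  (s + t) `^ p <= 2 `^ p * (s `^ p + t `^ p).
Proof.
move=> p0 s0 t0; wlog st : s t s0 t0 / s <= t.
  move=> h; have [/h->//|/ltW/h] := leP s t.
  by rewrite addrC [_ + s `^ p]addrC; apply.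
apply: (@le_trans _ _ ((2 * t) `^ p)).
  by apply: ler_powRl => //; lra.
by rewrite powRM// ler_wpM2l ?powR_ge0// lerDr powR_ge0.
Qed.

(** Young's inequality without its constants: replacing the smaller factor by the larger one leaves
    a single power p + q. *)
Lemma powRM_le p q s t : 0 < p -> 0 < q -> 0 <= s -> 0 <= t ->
  s `^ p * t `^ q <= s `^ (p + q) + t `^ (p + q).
Proof.
move=> p0 q0 s0 t0; have [st|/ltW ts] := leP s t.
  have [t_eq0|tn0] := eqVneq t 0.
    by rewrite t_eq0 (powR0 (lt0r_neq0 q0)) mulr0 addr_ge0 ?powR_ge0.
  apply: (@le_trans _ _ (t `^ (p + q))); last by rewrite lerDr powR_ge0.
  by rewrite powRD ?tn0 ?implybT// ler_wpM2r ?powR_ge0// ler_powRl// ltW.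
have [s_eq0|sn0] := eqVneq s 0.
  by rewrite s_eq0 powR0 ?gt_eqF// mul0r addr_ge0 ?powR_ge0.
apply: (@le_trans _ _ (s `^ (p + q))); last by rewrite lerDl powR_ge0.
by rewrite powRD ?sn0 ?implybT// ler_wpM2l ?powR_ge0// ler_powRl// ltW.
Qed.

End PowerInequalities.

Section Graph.
Context {R : realType} {V : choiceType} (E : rel V) (mu : V -> R) (p : R).
Hypotheses (Esym : symmetric E) (Efin : locally_finite_graph E).
Hypotheses (mu_gt0 : forall x, 0 < mu x) (p_gt0 : 0 < p).
Implicit Types (u v w a b phi : V -> R).

Lemma grad_ge0 u x : 0 <= grad E mu u x.
Proof. exact: sqrtr_ge0. Qed.

Lemma gradZ (c : R) u x :
  grad E mu (fun y => c * u y) x = `|c| * grad E mu u x.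
Proof.
rewrite /grad !fsbig_finite//=.
under eq_bigr do rewrite -mulrBr exprMn.
by rewrite -big_distrr/= mulrCA sqrtrM ?sqr_ge0// sqrtr_sqr.
Qed.

(** Comes from (s + t)^2 <= 2 s^2 + 2 t^2 summed over the neighbours. The factor 2 avoids
    Minkowski's inequality; only summability is at stake. *)
Lemma gradD_le u w x :
  grad E mu (fun y => u y + w y) x <= 2 * (grad E mu u x + grad E mu w x).
Proof.
have m0 : 0 <= (2 * mu x)^-1 by rewrite invr_ge0 mulr_ge0// ltW.
have sq f : grad E mu f x ^+ 2 =
    (2 * mu x)^-1 * \sum_(y <- fset_set [set y | E x y]) (f y - f x) ^+ 2.
  rewrite sqr_sqrtr fsbig_finite//= mulr_ge0//.
  by apply: sumr_ge0 => y _; rewrite sqr_ge0.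
have u0 := grad_ge0 u x; have w0 := grad_ge0 w x.
rewrite -(@ler_pXn2r _ 2) ?nnegrE ?grad_ge0//; last by lra.
apply: (@le_trans _ _ (2 * grad E mu u x ^+ 2 + 2 * grad E mu w x ^+ 2)).
  rewrite !sq !(mulrCA 2) -mulrDr ler_wpM2l//.
  rewrite !big_distrr/= -big_split/=; apply: ler_sum => y _.
  by have := sqr_ge0 ((u y - u x) - (w y - w x)); nra.
by nra.
Qed.

(** If the gradient at x is nonzero, then x or one of its neighbours y lies in the support. By
    symmetry x is then a neighbour of y, and the support has finitely many neighbours in all. *)
Lemma grad_fin_supp phi : Cc phi -> finite_set [set x | grad E mu phi x != 0].
Proof.
move=> phifin.
apply: (@sub_finite_set _ _ ([set x | phi x != 0] `|`
    \bigcup_(y in [set x | phi x != 0]) [set x | E y x])); last first.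
  by rewrite finite_setU; split=> //; exact: bigcup_finite.
move=> x /= gx; apply: contrapT => /not_orP[/negP].
rewrite negbK => /eqP phix nbr; move/eqP: gx; apply.
rewrite /grad fsbig1 ?mulr0 ?sqrtr0// => y Exy.
have -> : phi y = 0; last by rewrite phix subrr expr0n.
apply/eqP/negPn/negP => phiy; apply: nbr; exists y => //=.
by rewrite Esym.
Qed.

Let energy u x := grad E mu u x `^ p + `|u x| `^ p.

Let energy_ge0 u x : 0 <= energy u x.
Proof. by rewrite addr_ge0 ?powR_ge0. Qed.

Let energyD u w x :
  energy (fun y => u y + w y) x <= 4 `^ p * (energy u x + energy w x).
Proof.
have u0 := grad_ge0 u x; have w0 := grad_ge0 w x.
have -> : 4 `^ p * (energy u x + energy w x) =
    4 `^ p * (grad E mu u x `^ p + grad E mu w x `^ p) +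
    4 `^ p * (`|u x| `^ p + `|w x| `^ p) by rewrite /energy; ring.
have le4 s t : 0 <= s -> 0 <= t ->
    (2 * (s + t)) `^ p <= 4 `^ p * (s `^ p + t `^ p).
  move=> s0 t0; rewrite mulrDr (le_trans (powRD_le (ltW p_gt0) _ _)) ?mulr_ge0//.
  by rewrite !powRM// -mulrDr mulrA -powRM// -natrM.
apply: lerD.
  apply: le_trans (le4 _ _ u0 w0); apply: ler_powRl.
  - exact: ltW.
  - exact: grad_ge0.
  - exact: gradD_le.
apply: le_trans (le4 _ _ (normr_ge0 _) (normr_ge0 _)).
apply: ler_powRl; rewrite ?(ltW p_gt0)// (le_trans (ler_normD _ _))//.
by have := normr_ge0 (u x); have := normr_ge0 (w x); lra.
Qed.

(** Membership in the closure is used only at distance 1: u = (u - phi) + phi, where u - phi has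
    finite norm and phi is finitely supported. *)
Lemma W1p_integrable u : W1p E mu p u ->
  integrableV mu (fun x => grad E mu u x `^ p) /\
  integrableV mu (fun x => `|u x| `^ p).
Proof.
move=> /(_ 1 ltr01)[phi phiC]; rewrite /W1p_norm -/(energy (fun y => u y - phi y)).
move=> /lt_trans/(_ (ltry _))/lty_poweRy; rewrite invr_eq0 gt_eqF// => /(_ isT).
move=> /(eintegralV_lty mu_gt0 (energy_ge0 _)) Iuphi.
have Iphi : integrableV mu (energy phi).
  apply: integrableVD; apply: integrableV_fin_supp.
    apply: sub_finite_set (grad_fin_supp phiC) => x /=.
    by apply: contra_neq => ->; rewrite powR0// gt_eqF.
  apply: sub_finite_set phiC => x /=.
  by apply: contra_neq => ->; rewrite normr0 powR0// gt_eqF.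
have Iu : integrableV mu (energy u).
  apply: (integrableV_le _ (integrableVZ (4 `^ p) (integrableVD Iuphi Iphi))).
  move=> x; rewrite ger0_norm ?energy_ge0//; apply: le_trans (energyD _ _ x).
  by under eq_fun do rewrite subrK.
split; apply: integrableV_le Iu => x; rewrite ger0_norm ?powR_ge0// /energy.
  by rewrite lerDl powR_ge0.
by rewrite lerDr powR_ge0.
Qed.

Lemma W1pZ (c : R) u : c != 0 -> W1p E mu p u -> W1p E mu p (fun x => c * u x).
Proof.
move=> c0 Wu e e0.
have nc0 : 0 < `|c| by rewrite normr_gt0.
have [phi phiC phie] := Wu (e / `|c|) (divr_gt0 e0 nc0).
exists (fun x => c * phi x).
  by apply: sub_finite_set phiC => x /=; apply: contra_neq => ->; rewrite mulr0.
have -> : (fun x => c * u x - c * phi x) = (fun x => c * (u x - phi x)).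
  by apply/funext => x; rewrite mulrBr.
set w := fun x => u x - phi x.
rewrite /W1p_norm -/(energy (fun y => c * w y)).
have -> : energy (fun y => c * w y) = fun x => `|c| `^ p * energy w x.
  apply/funext => x; rewrite /energy gradZ normrM !powRM ?grad_ge0//.
  by rewrite mulrDr.
have -> : eintegralV mu (fun x => `|c| `^ p * energy w x) =
    ((`|c| `^ p)%:E * eintegralV mu (energy w))%E.
  rewrite !eintegralV_ge0E//; last by move=> x; rewrite mulr_ge0 ?powR_ge0.
  rewrite -esumZ ?powR_ge0//; last first.
    by move=> x; rewrite lee_fin mulr_ge0// ltW.
  by apply: eq_esum => x _; rewrite -EFinM mulrA.
rewrite poweRM ?lee_fin ?powR_ge0 ?eintegralV_ge0//.
rewrite poweR_EFin -powRrM mulfV ?gt_eqF// powRr1//.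
by rewrite -lte_pdivlMl// muleC.
Qed.

Lemma H_spaceP a u : (forall x, 0 <= a x) ->
  H_space E mu p a u <->
  W1p E mu p u /\ integrableV mu (fun x => a x * `|u x| `^ p).
Proof.
move=> a0; split=> -[Wu Iau]; split=> //; apply/(eintegralV_lty mu_gt0) => // x.
all: by rewrite mulr_ge0 ?powR_ge0.
Qed.

Lemma H_spaceZ a u (c : R) : (forall x, 0 <= a x) -> c != 0 ->
  H_space E mu p a u -> H_space E mu p a (fun x => c * u x).
Proof.
move=> a0 c0 /(H_spaceP _ a0)[Wu Iu]; apply/(H_spaceP _ a0).
split; first exact: W1pZ.
have := integrableVZ (`|c| `^ p) Iu; congr (integrableV mu _).
by apply/funext => x; rewrite normrM powRM//; ring.
Qed.

End Graph.

(** * The functional along rays *)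

(** From ln (t^2) < 2 t at t = s and t = 1/s. The linear term is tailored to (A2'): multiplied by a
    power p - 2 it has degree p - 1. *)
Lemma sqr_ln_sqr_le (R : realType) (s : R) : 0 <= s ->
  `|s ^+ 2 * ln (s ^+ 2)| <= 2 * s + 2 * s ^+ 3.
Proof.
rewrite le_eqVlt => /predU1P[<-|s0].
  by rewrite !expr0n/= mul0r normr0 !mulr0 addr0.
have ln_lt (t : R) : 0 < t -> ln (t ^+ 2) < 2 * t.
  by move=> t0; have := ln_sublinear t0; rewrite lnXn// mulr2n; lra.
rewrite normrM ger0_norm ?sqr_ge0//.
have : `|ln (s ^+ 2)| <= 2 * s^-1 + 2 * s.
  have [s1|s1] := leP 0 (ln (s ^+ 2)).
    by rewrite ger0_norm// (le_trans (ltW (ln_lt _ s0)))// lerDr mulr_ge0// invr_ge0 ltW.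
  rewrite ltr0_norm// -lnV ?posrE ?exprn_gt0// -exprVn.
  by rewrite (le_trans (ltW (ln_lt _ _)))// ?invr_gt0// lerDl mulr_ge0// ltW.
move=> /(ler_wpM2l (sqr_ge0 s))/le_trans; apply.
rewrite le_eqVlt; apply/orP; left; apply/eqP.
by field; rewrite gt_eqF.
Qed.

(** Source of the term 2 K ln t in the ray formula. At [s = 0] the prefactor makes both sides
    vanish. *)
Lemma lnM_sqr (R : realType) (t s : R) : 0 < t ->
  s ^+ 2 * ln ((t * s) ^+ 2) = s ^+ 2 * ln (s ^+ 2) + 2 * ln t * s ^+ 2.
Proof.
move=> t0; have [->|s0] := eqVneq s 0.
  by rewrite expr0n/= !mulr0 !mul0r addr0.
have s20 : 0 < s ^+ 2 by rewrite lt0r sqr_ge0 sqrf_eq0 s0.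
have t20 : 0 < t ^+ 2 by rewrite exprn_gt0.
rewrite exprMn lnM ?posrE// (lnXn 2 t0) mulr2n.
by ring.
Qed.

Section Functional.
Context {R : realType} {V : choiceType} (E : rel V) (mu : V -> R).
Context (mumin p : R).
Hypotheses (Esym : symmetric E) (Efin : locally_finite_graph E).
Hypotheses (mumin_gt0 : 0 < mumin) (mu_ge : forall x, mumin <= mu x).
Hypotheses (p_gt4 : 4 < p).
Implicit Types (u v w a b : V -> R).

Let mu_gt0 x : 0 < mu x. Proof. exact: lt_le_trans (mu_ge x). Qed.
Let p_gt0 : 0 < p. Proof. by have := p_gt4; lra. Qed.
Let pB1_gt0 : 0 < p - 1. Proof. by have := p_gt4; lra. Qed.
Let pB2_gt0 : 0 < p - 2. Proof. by have := p_gt4; lra. Qed.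

Lemma integrableV_patch (D : set V) f :
  L1_on mu D f -> integrableV mu (fun x => if x \in D then f x else 0).
Proof.
rewrite /L1_on /integrableV /summable esum_mkcond.
rewrite [X in (X < _)%E -> _](_ : _ = \esum_(x in setT)
  `|((if x \in D then f x else 0) * mu x)%:E|)%E//.
by apply: eq_esum => x _; case: ifP => //; rewrite mul0r ?abse_EFin ?normr0.
Qed.

Definition hypA2'_single a : Prop := exists M0 : R,
  [/\ 0 < M0, (volume mu [set x | (a x <= M0)%R] < +oo)%E &
      L1_on mu (~` [set x | a x <= M0]) (fun x => (a x)^-1)].

(* Off [a <= M0]: if |u| >= 1/a then |u|^(p-1) <= a |u|^p, and otherwise
   |u|^(p-1) < (1/a)^(p-1) <= M0^(2-p) / a. *)
Lemma integrableV_powB1 a u : hypA2'_single a -> (forall x, 0 <= a x) ->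
  integrableV mu (fun x => `|u x| `^ p) ->
  integrableV mu (fun x => a x * `|u x| `^ p) ->
  integrableV mu (fun x => `|u x| `^ (p - 1)).
Proof.
move=> [M0 [M00 volM0 L1M0]] a0 Iu Iau.
(* On the finite-volume set, |u|^(p-1) is at most |u|^p where |u| >= 1 and at most the constant 1
   elsewhere. *)
have I1 : L1_on mu [set x | a x <= M0] (fun=> 1).
  apply: le_lt_trans volM0; apply: le_esum => x _.
  by rewrite mul1r gee0_abs// lee_fin ltW.
have Ibound := integrableVD (integrableVD Iu Iau) (integrableVD
  (integrableV_patch I1) (integrableVZ (M0^-1 `^ (p - 2)) (integrableV_patch L1M0))).
apply: integrableV_le Ibound => x; rewrite ger0_norm ?powR_ge0//.
have up0 : 0 <= `|u x| `^ p by exact: powR_ge0.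
have aup0 : 0 <= a x * `|u x| `^ p by exact: mulr_ge0.
have upE : `|u x| `^ p = `|u x| * `|u x| `^ (p - 1) by rewrite mulr_powRB1.
have [p1 p2] := (ltW pB1_gt0, ltW pB2_gt0).
have [axM|axM] := leP (a x) M0.
  rewrite (mem_set (axM : [set x | a x <= M0] x)) memNset/=; last first.
    by move=> /(_ axM).
  rewrite mulr0 addr0; have [u1|u1] := leP 1 `|u x|.
    have : `|u x| `^ (p - 1) <= `|u x| `^ p by apply: ler_powR => //; lra.
    by lra.
  have : `|u x| `^ (p - 1) <= 1 `^ (p - 1) by apply: ler_powRl => //; exact: ltW.
  by rewrite powR1; lra.
have xM : (~` [set x | a x <= M0]) x by move=> /=; rewrite leNgt axM.
rewrite (memNset (xM : ~ [set x | a x <= M0] x)) (mem_set xM) add0r.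
have ax0 : 0 < a x by exact: lt_trans axM.
have [ua|/ltW ua] := leP (a x)^-1 `|u x|.
  have : `|u x| `^ (p - 1) <= a x * `|u x| `^ p.
    rewrite upE mulrA ler_peMl ?powR_ge0//.
    by rewrite -(mulfV (lt0r_neq0 ax0)) ler_wpM2l// ltW.
  have : 0 <= M0^-1 `^ (p - 2) * (a x)^-1 by rewrite mulr_ge0 ?powR_ge0 ?invr_ge0.
  by lra.
have : `|u x| `^ (p - 1) <= M0^-1 `^ (p - 2) * (a x)^-1.
  rewrite -(@mulr_powRB1 _ _ (p - 1))//.
  rewrite mulrC (_ : p - 1 - 1 = p - 2); last by ring.
  apply: ler_pM => //.
  apply: ler_powRl => //; apply: (le_trans ua).
  by rewrite lef_pV2 ?posrE// ltW.
by lra.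
Qed.

Definition mixed u v x := `|u x| `^ (p - 2) * v x ^+ 2.
Definition mixed_log u v x := `|u x| `^ (p - 2) * (v x ^+ 2 * ln (v x ^+ 2)).

Lemma mixed_ge0 u v x : 0 <= mixed u v x.
Proof. by rewrite mulr_ge0 ?powR_ge0 ?sqr_ge0. Qed.

Lemma mixed_le u v x : mixed u v x <= `|u x| `^ p + `|v x| `^ p.
Proof.
have := @powRM_le _ (p - 2) 2 `|u x| `|v x|.
by rewrite subrK powR_mulrn// real_normK ?num_real//; apply => //; lra.
Qed.

Lemma integrableV_mixed u v : integrableV mu (fun x => `|u x| `^ p) ->
  integrableV mu (fun x => `|v x| `^ p) -> integrableV mu (mixed u v).
Proof.
move=> Iu Iv; apply: integrableV_le (integrableVD Iu Iv) => x.
by rewrite ger0_norm ?mixed_ge0 ?mixed_le.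
Qed.

(** The embedding into bounded functions: one term of a sum of nonnegative terms is at most the sum,
    and [mu x >= mumin]. *)
Lemma sup_bound u x : integrableV mu (fun x => `|u x| `^ p) ->
  `|u x| `^ p <= integralV mu (fun x => `|u x| `^ p) / mumin.
Proof.
move=> Iu; rewrite ler_pdivlMr//.
apply: le_trans (term_le_integralV mu_gt0 x _ Iu).
  by rewrite ler_wpM2l ?powR_ge0.
by move=> y; rewrite powR_ge0.
Qed.

(** In the bound 2 |v| + 2 |v|^3 for v^2 |ln v^2|, the linear term gives |u|^(p-2) |v|, of degree p
    - 1; the cubic one gives the bounded factor |v| times [mixed u v]. *)
Lemma integrableV_mixed_log u v : integrableV mu (fun x => `|u x| `^ p) ->
  integrableV mu (fun x => `|v x| `^ p) ->
  integrableV mu (fun x => `|u x| `^ (p - 1)) ->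
  integrableV mu (fun x => `|v x| `^ (p - 1)) ->
  integrableV mu (mixed_log u v).
Proof.
move=> Iu Iv Iu1 Iv1.
set I := integralV mu (fun x => `|v x| `^ p) / mumin.
have I0 : 0 <= I.
  by rewrite divr_ge0 ?integralV_ge0// ?ltW// => x; rewrite powR_ge0.
(* Where |v| >= 1, |v| <= |v|^p <= I; elsewhere 1 suffices. *)
have vI x : `|v x| <= I + 1.
  have [v1|v1] := leP 1 `|v x|; last by lra.
  apply: (@le_trans _ _ (`|v x| `^ p)); last first.
    by apply: le_trans (sup_bound x Iv) _; rewrite -/I lerDl.
  by rewrite le1r_powR//; have := p_gt4; lra.
apply: (integrableV_le _ (integrableVD (integrableVZ 2 (integrableVD Iu1 Iv1))
  (integrableVZ (2 * (I + 1)) (integrableVD Iu Iv)))) => x.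
have := sqr_ln_sqr_le (normr_ge0 (v x)).
rewrite real_normK ?num_real// => lnv.
rewrite /mixed_log normrM ger0_norm ?powR_ge0//.
apply: (le_trans (ler_wpM2l (powR_ge0 _ _) lnv)); rewrite mulrDr; apply: lerD.
  rewrite mulrCA ler_wpM2l//.
  have := @powRM_le _ (p - 2) 1 `|u x| `|v x|.
  rewrite powRr1// (_ : p - 2 + 1 = p - 1); last by ring.
  by apply => //; lra.
have -> : `|u x| `^ (p - 2) * (2 * `|v x| ^+ 3) = 2 * `|v x| * mixed u v x.
  by rewrite /mixed -(real_normK (num_real (v x))); ring.
apply: ler_pM; [exact: mulr_ge0|exact: mixed_ge0| |exact: mixed_le].
by rewrite ler_wpM2l.
Qed.

Definition energy_form a u :=
  integralV mu (fun x => grad E mu u x `^ p + a x * `|u x| `^ p).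
Definition Aform a b u v := energy_form a u + energy_form b v.
Definition Bform u v :=
  integralV mu (mixed_log u v) + integralV mu (mixed_log v u).
Definition Kform u v := integralV mu (mixed u v) + integralV mu (mixed v u).

(** What the ray computation needs: with all these integrands summable, every integral in [J] can be
    split and rescaled, and nonnegative potentials let the root in [H_norm] cancel against the power
    p. *)
Definition regular_pair a b u v := [/\ forall x, 0 <= a x, forall x, 0 <= b x,
  integrableV mu (fun x => grad E mu u x `^ p + a x * `|u x| `^ p),
  integrableV mu (fun x => grad E mu v x `^ p + b x * `|v x| `^ p) &
  [/\ integrableV mu (mixed u v), integrableV mu (mixed v u),
      integrableV mu (mixed_log u v) & integrableV mu (mixed_log v u)]].

Lemma J_scale a b u v (t : R) : regular_pair a b u v -> 0 < t ->
  J E mu p a b (fun x => t * u x) (fun x => t * v x) =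
  p^-1 * (t `^ p * (Aform a b u v - Bform u v - 2 * Kform u v * ln t)).
Proof.
move=> [a0 b0 Iu Iv [Kuv Kvu Buv Bvu]] t0; have t_ge0 := ltW t0.
have normE (c w : V -> R) : (forall x, 0 <= c x) ->
    integrableV mu (fun x => grad E mu w x `^ p + c x * `|w x| `^ p) ->
    H_norm E mu p c (fun x => t * w x) `^ p = t `^ p * energy_form c w.
  move=> c0 Iw; rewrite /H_norm -powRrM mulVf ?gt_eqF// powRr1; last first.
    by apply: integralV_ge0 => // x; rewrite addr_ge0 ?mulr_ge0 ?powR_ge0.
  rewrite -integralVZ//; apply: integralV_ext => x.
  by rewrite (gradZ _ Efin) normrM gtr0_norm// !powRM ?grad_ge0//; ring.
have logE (w z : V -> R) :
    integrableV mu (mixed w z) -> integrableV mu (mixed_log w z) ->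
    integralV mu (mixed_log (fun x => t * w x) (fun x => t * z x)) =
    t `^ p *
      (integralV mu (mixed_log w z) + 2 * ln t * integralV mu (mixed w z)).
  move=> Iwz Lwz; rewrite -(integralVZ _ _ Iwz)//.
  rewrite -integralVD//; last exact: integrableVZ.
  rewrite -integralVZ//; last by apply: integrableVD => //; exact: integrableVZ.
  apply: integralV_ext => x; rewrite /mixed_log /mixed.
  have -> : t `^ p = t `^ (p - 2) * t ^+ 2.
    by rewrite -powR_mulrn// -powRD ?subrK// gt_eqF ?implybT.
  rewrite normrM gtr0_norm// powRM//.
  have -> : (t * z x) ^+ 2 * ln ((t * z x) ^+ 2) =
      t ^+ 2 * (z x ^+ 2 * ln ((t * z x) ^+ 2)) by rewrite exprMn mulrA.
  by rewrite lnM_sqr//; ring.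
transitivity (p^-1 * (t `^ p * energy_form a u + t `^ p * energy_form b v) -
    p^-1 * (t `^ p * (integralV mu (mixed_log u v) +
      2 * ln t * integralV mu (mixed u v))) -
    p^-1 * (t `^ p * (integralV mu (mixed_log v u) +
      2 * ln t * integralV mu (mixed v u)))).
  congr (p^-1 * (_ + _) - p^-1 * _ - p^-1 * _).
  - exact: normE.
  - exact: normE.
  - exact: logE.
  - exact: logE.
by rewrite /Aform /Bform /Kform; ring.
Qed.

(** The variable is 1 + t because [is_dJ] in the direction (u, v) itself moves along (1 + t) (u,
    v). *)
Lemma is_derive_fiber (alpha beta : R) :
  is_derive (0 : R) (1 : R)
    (fun t => p^-1 * ((1 + t) `^ p * (alpha - beta * ln (1 + t))))
    (alpha - p^-1 * beta).
Proof.
have d1 : is_derive (0 : R) (1 : R) (fun t : R => 1 + t) 1.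
  have : is_derive (0 : R) (1 : R) (cst (1 : R) + id) (0 + 1) by exact: is_deriveD.
  by rewrite add0r.
have dpow : is_derive (0 : R) (1 : R) (fun t : R => (1 + t) `^ p) p.
  apply: (is_derive_eq (f' := (p * 1 `^ (p - 1)) * 1)).
    by apply: (is_derive1_comp (f := fun s => s `^ p)); rewrite addr0; exact: is_derive1_powR.
  by rewrite powR1 !mulr1.
have dln : is_derive (0 : R) (1 : R) (fun t : R => ln (1 + t)) 1.
  apply: (is_derive_eq (f' := (1 : R)^-1 * 1)).
    by apply: (is_derive1_comp (f := @ln R)); rewrite addr0; exact: is_derive1_ln.
  by rewrite invr1 mulr1.
have -> : (fun t => p^-1 * ((1 + t) `^ p * (alpha - beta * ln (1 + t)))) =
    p^-1 *: ((fun t => (1 + t) `^ p) * (cst alpha - beta *: (fun t => ln (1 + t)))).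
  by apply/funext.
apply: is_derive_eq.
have -> : (cst alpha - beta *: (fun t => ln (1 + t))) (0 : R) =
  alpha - beta * ln (1 + 0) by [].
rewrite /GRing.scale/= !addr0 powR1 ln1; field; exact: lt0r_neq0.
Qed.

Lemma is_dJ_fiber a b u v (t : R) : regular_pair a b u v -> 0 < t ->
  is_dJ E mu p a b (fun x => t * u x) (fun x => t * v x)
    (fun x => t * u x) (fun x => t * v x)
    (t `^ p * (Aform a b u v - Bform u v - 2 * Kform u v * (ln t + p^-1))).
Proof.
move=> reg t0; rewrite /is_dJ.
set alpha := t `^ p * (Aform a b u v - Bform u v - 2 * Kform u v * ln t).
set beta := t `^ p * (2 * Kform u v).
have -> : t `^ p * (Aform a b u v - Bform u v - 2 * Kform u v * (ln t + p^-1)) =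
  alpha - p^-1 * beta by rewrite /alpha /beta; ring.
(* The ray formula holds only for positive factors, so the two functions are compared where 1 + s >
   0. *)
apply: near_eq_is_derive (is_derive_fiber alpha beta).
near=> s.
have s1 : 0 < 1 + s.
  suff : -1 < s by lra.
  by near: s; apply: lt_nbhsr; rewrite ltrN10.
have scaled (w : V -> R) : (fun x => t * w x + s * (t * w x)) =
    (fun x => ((1 + s) * t) * w x) by apply/funext => x; ring.
rewrite !scaled (J_scale reg) ?mulr_gt0// lnM ?posrE// powRM ?ltW//.
by rewrite /alpha /beta; ring.
Unshelve. all: by end_near. Qed.

End Functional.

(** * Perturbation of the potentials *)

(** The inequality 1 + ln y <= y at y = x gives k <= K. At y = sqrt x it improves the hypothesis to
    k sqrt x <= 2 K, whose square is the second bound. *)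
Lemma ln_ge_linear (R : realType) (k x K : R) : 0 < k -> 0 < x ->
  k * x <= (1 + ln x) * K -> 0 < K -> k <= K /\ k ^+ 2 * x <= 4 * K ^+ 2.
Proof.
move=> k0 x0 kxK K0.
have ln_le (y : R) : 0 < y -> 1 + ln y <= y.
  move=> y0; have y1 : -1 < y - 1 by lra.
  by have := le_ln1Dx y1; rewrite addrC subrK; lra.
split.
  by have := ln_le x x0; nra.
have [s s0 xE] : exists2 s, 0 < s & x = s ^+ 2.
  by exists (Num.sqrt x); rewrite ?sqrtr_gt0// sqr_sqrtr// ltW.
move: kxK; rewrite xE lnXn// mulr2n => ksK.
have lns := ln_le s s0.
have : k * s * s <= 2 * K * s by nra.
rewrite ler_pM2r// => ks.
have : (k * s) ^+ 2 <= (2 * K) ^+ 2.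
  by rewrite ler_pXn2r// nnegrE ?mulr_ge0// ltW.
by rewrite !exprMn; lra.
Qed.

Section Perturbation.
Context {R : realType} {V : choiceType} (E : rel V) (mu : V -> R).
Context (mumin p : R).
Hypotheses (Esym : symmetric E) (Efin : locally_finite_graph E).
Hypotheses (mumin_gt0 : 0 < mumin) (mu_ge : forall x, mumin <= mu x).
Hypotheses (p_gt4 : 4 < p).
Implicit Types (u v w a b : V -> R).

Let mu_gt0 x : 0 < mu x. Proof. exact: lt_le_trans (mu_ge x). Qed.
Let p_gt0 : 0 < p. Proof. by have := p_gt4; lra. Qed.
Let pB2_gt0 : 0 < p - 2. Proof. by have := p_gt4; lra. Qed.

Let normp_ge0 u x : 0 <= `|u x| `^ p. Proof. exact: powR_ge0. Qed.

Local Notation A := (Aform E mu p).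
Local Notation B := (Bform mu p).
Local Notation K := (Kform mu p).
Local Notation mass u := (integralV mu (fun x => `|u x| `^ p)).

(* A consequence of (A1) and (A2') that, unlike (A2') itself, visibly survives
   bounded perturbations of a. *)
Definition confining (c : R) a := [/\ 0 < c, forall x, c <= a x &
  forall u, integrableV mu (fun x => `|u x| `^ p) ->
    integrableV mu (fun x => a x * `|u x| `^ p) ->
    integrableV mu (fun x => `|u x| `^ (p - 1))].

Lemma confining_hypA2' c a : 0 < c -> (forall x, c <= a x) -> hypA2'_single mu a ->
  confining c a.
Proof.
move=> c0 ca A2a; split=> // u.
apply: (integrableV_powB1 mumin_gt0 mu_ge p_gt4 A2a) => x.
by rewrite (le_trans (ltW c0)).
Qed.

Lemma integrableV_bounded (M : R) (d : V -> R) u : (forall x, `|d x| <= M) ->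
  integrableV mu (fun x => `|u x| `^ p) ->
  integrableV mu (fun x => d x * `|u x| `^ p).
Proof.
move=> dM Iu; apply: integrableV_le (integrableVZ M Iu) => // x.
by rewrite normrM [X in _ * X]ger0_norm// ler_wpM2r.
Qed.

Lemma integrableV_perturb (M : R) a a' u : (forall x, `|a' x - a x| <= M) ->
  integrableV mu (fun x => `|u x| `^ p) ->
  integrableV mu (fun x => a x * `|u x| `^ p) ->
  integrableV mu (fun x => a' x * `|u x| `^ p).
Proof.
move=> aM Iu Ia; have := integrableVD Ia (integrableV_bounded aM Iu).
by congr (integrableV mu _); apply/funext => x; ring.
Qed.

(** When |u|^p is summable, a bounded change of a does not affect the summability of a |u|^p, so the
    last clause carries over; only the lower bound must be supplied anew. *)
Lemma confining_perturb (M c c' : R) a a' : 0 < c' -> (forall x, c' <= a' x) ->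
  (forall x, `|a' x - a x| <= M) -> confining c a -> confining c' a'.
Proof.
move=> c'0 c'a' aM [_ _ pow_a]; split=> // u Iu Ia'; apply: pow_a => //.
by apply: (@integrableV_perturb M a') => // x; rewrite distrC.
Qed.

Lemma confining_ge0 c a : confining c a -> forall x, 0 <= a x.
Proof. by move=> [c0 ca _] x; rewrite (le_trans (ltW c0)). Qed.

Lemma H_space_integrable c a u : confining c a -> H_space E mu p a u ->
  [/\ integrableV mu (fun x => grad E mu u x `^ p),
      integrableV mu (fun x => `|u x| `^ p),
      integrableV mu (fun x => a x * `|u x| `^ p) &
      integrableV mu (fun x => `|u x| `^ (p - 1))].
Proof.
move=> conf; have a0 := confining_ge0 conf.
move=> /(H_spaceP E p mu_gt0 u a0)[Wu Ia].
have [Ig Iu] := W1p_integrable Esym Efin mu_gt0 p_gt0 Wu.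
have [_ _ pow_a] := conf.
exact: And4 Ig Iu Ia (pow_a u Iu Ia).
Qed.

Lemma H_space_perturb (M c : R) a a' u : (forall x, 0 <= a' x) ->
  (forall x, `|a' x - a x| <= M) -> confining c a ->
  H_space E mu p a u -> H_space E mu p a' u.
Proof.
move=> a'0 aM conf Hu; have [_ Iu Ia _] := H_space_integrable conf Hu.
apply/(H_spaceP E p mu_gt0 u a'0); split; first by case: Hu.
exact: integrableV_perturb aM Iu Ia.
Qed.

Lemma H_space_regular c a b u v : confining c a -> confining c b ->
  H_space E mu p a u -> H_space E mu p b v -> regular_pair E mu p a b u v.
Proof.
move=> confa confb Hu Hv.
have [Igu Iu Iau Iu1] := H_space_integrable confa Hu.
have [Igv Iv Ibv Iv1] := H_space_integrable confb Hv.
split; [exact: confining_ge0 confa|exact: confining_ge0 confb|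
        exact: integrableVD|exact: integrableVD|].
by split; [exact: (integrableV_mixed p_gt4)|exact: (integrableV_mixed p_gt4)|
  exact: (integrableV_mixed_log mumin_gt0 mu_ge p_gt4)|
  exact: (integrableV_mixed_log mumin_gt0 mu_ge p_gt4)].
Qed.

(** The ray derivative at t = 1. As [is_dJ] is a relation, the forward direction rests on uniqueness
    of the derivative. *)
Lemma is_dJ0P a b u v : regular_pair E mu p a b u v ->
  is_dJ E mu p a b u v u v 0 <-> A a b u v - B u v = 2 * K u v / p.
Proof.
move=> reg; have := is_dJ_fiber Efin mumin_gt0 mu_ge p_gt4 reg ltr01.
have scale1 w : (fun x => 1 * w x) = w by apply/funext => x; rewrite mul1r.
rewrite !scale1 powR1 ln1 add0r mul1r => dJ; split=> [dJ0|AB].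
  have := @derive_val _ _ _ _ _ _ _ dJ.
  by rewrite (@derive_val _ _ _ _ _ _ _ dJ0) => /esym/subr0_eq.
by move: dJ; rewrite AB subrr.
Qed.

Lemma J_regular a b u v : regular_pair E mu p a b u v ->
  J E mu p a b u v = p^-1 * (A a b u v - B u v).
Proof.
move=> reg; have := J_scale Efin mumin_gt0 mu_ge p_gt4 reg ltr01.
have scale1 w : (fun x => 1 * w x) = w by apply/funext => x; rewrite mul1r.
by rewrite !scale1 powR1 ln1 mulr0 subr0 mul1r.
Qed.

Lemma ground_energy_le_fiber c a b u v : confining c a -> confining c b ->
  H_space E mu p a u -> H_space E mu p b v -> 0 < K u v ->
  (ground_energy E mu p a b <= (2 * K u v / p ^+ 2 *
     expR (p * (A a b u v - B u v) / (2 * K u v) - 1))%:E)%E.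
Proof.
move=> confa confb Hu Hv K0; have reg := H_space_regular confa confb Hu Hv.
(* The logarithm of the ray parameter at which the derivative vanishes: ln t + 1/p = (A - B) / (2
   K). *)
set s := (A a b u v - B u v) / (2 * K u v) - p^-1.
have t0 : 0 < expR s by exact: expR_gt0.
have pn0 : p != 0 by exact: lt0r_neq0.
have Kn0 : K u v != 0 by exact: lt0r_neq0.
have Jt : J E mu p a b (fun x => expR s * u x) (fun x => expR s * v x) =
    2 * K u v / p ^+ 2 * expR (p * (A a b u v - B u v) / (2 * K u v) - 1).
  rewrite (J_scale Efin mumin_gt0 mu_ge p_gt4 reg t0) expRK -expRM.
  have -> : s * p = p * (A a b u v - B u v) / (2 * K u v) - 1.
    by rewrite /s; field; rewrite pn0 Kn0.
  by rewrite /s; field; rewrite pn0 Kn0.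
rewrite -Jt; apply: ereal_inf_lbound => /=.
exists (fun x => expR s * u x, fun x => expR s * v x); last by reflexivity.
split.
- exact: (H_spaceZ Efin mu_gt0 p_gt0 (confining_ge0 confa) (lt0r_neq0 t0) Hu).
- exact: (H_spaceZ Efin mu_gt0 p_gt0 (confining_ge0 confb) (lt0r_neq0 t0) Hv).
- move=> [eu ev]; move: K0; rewrite /Kform.
  have zero w : (fun x => expR s * w x) = cst 0 -> w =1 cst 0.
    move=> ew x; have /eqP := congr1 (fun f => f x) ew.
    by rewrite mulf_eq0 gt_eqF//= => /eqP.
  have mixed0 w z : z =1 cst 0 -> integralV mu (mixed p w z) = 0.
    move=> z0; rewrite (@integralV_ext _ _ _ _ (fun=> 0)) ?integralV0//.
    by move=> x; rewrite /mixed z0 expr0n mulr0.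
  by rewrite !mixed0 ?addr0 ?ltxx//; exact: zero.
- have := is_dJ_fiber Efin mumin_gt0 mu_ge p_gt4 reg t0.
  congr (is_dJ _ _ _ _ _ _ _ _ _ _).
  by rewrite expRK /s; field; rewrite pn0.
Qed.

Lemma Kform_ge0 u v : 0 <= K u v.
Proof.
by rewrite addr_ge0// integralV_ge0// => x; rewrite mixed_ge0.
Qed.

(** Since ln (v^2) = (2/p) ln (|v|^p), a pointwise bound on |v|^p pulls the logarithm out of the
    integral. *)
Lemma mixed_log_le (x : R) u v y : 0 < x -> `|v y| `^ p <= x ->
  mixed_log p u v y <= 2 / p * ln x * mixed p u v y.
Proof.
move=> x0 vx; have [v0|v0] := eqVneq (v y) 0.
  by rewrite /mixed_log /mixed v0 expr0n mul0r !mulr0.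
have nv0 : 0 < `|v y| by rewrite normr_gt0.
have -> : mixed_log p u v y = ln (v y ^+ 2) * mixed p u v y.
  by rewrite /mixed_log /mixed; ring.
rewrite ler_wpM2r ?mixed_ge0// -(real_normK (num_real (v y))) lnXn// mulr2n.
have : p * ln `|v y| <= ln x.
  by rewrite -ln_powR ler_ln ?posrE// powR_gt0.
move=> /(ler_wpM2l (divr_ge0 (ler0n R 2) (ltW p_gt0) : 0 <= 2 / p)).
have -> // : 2 / p * (p * ln `|v y|) = ln `|v y| + ln `|v y|.
by field; exact: lt0r_neq0.
Qed.

Lemma mass_le_A c a b u v : confining c a -> confining c b ->
  H_space E mu p a u -> H_space E mu p b v -> c * (mass u + mass v) <= A a b u v.
Proof.
move=> confa confb Hu Hv.
have half d w : confining c d -> H_space E mu p d w ->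
    c * mass w <= energy_form E mu p d w.
  move=> confd Hw; have [Ig Iw Id _] := H_space_integrable confd Hw.
  rewrite -integralVZ//; apply: le_integralV => //.
  - exact: integrableVZ.
  - exact: integrableVD.
  - move=> x; case: confd => _ cd _.
    apply: (@le_trans _ _ (d x * `|w x| `^ p)); first by rewrite ler_wpM2r.
    by rewrite lerDr powR_ge0.
by rewrite mulrDr; apply: lerD; apply: half.
Qed.

Lemma Kform_le_mass u v : integrableV mu (fun x => `|u x| `^ p) ->
  integrableV mu (fun x => `|v x| `^ p) -> K u v <= 2 * (mass u + mass v).
Proof.
move=> Iu Iv; have half w z : integrableV mu (fun x => `|w x| `^ p) ->
    integrableV mu (fun x => `|z x| `^ p) ->
    integralV mu (mixed p w z) <= mass w + mass z.
  move=> Iw Iz; rewrite -integralVD//; apply: le_integralV => //.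
  - exact: (integrableV_mixed p_gt4).
  - exact: integrableVD.
  - by move=> x; apply: (mixed_le p_gt4).
by rewrite mulr_natl mulr2n {2}[mass u + _]addrC; apply: lerD; exact: half.
Qed.

Lemma Bform_le (x : R) u v : integrableV mu (mixed p u v) ->
  integrableV mu (mixed p v u) -> integrableV mu (mixed_log p u v) ->
  integrableV mu (mixed_log p v u) -> 0 < x ->
  (forall y, `|u y| `^ p <= x) -> (forall y, `|v y| `^ p <= x) ->
  B u v <= 2 / p * ln x * K u v.
Proof.
move=> Kuv Kvu Luv Lvu x0 ux vx; rewrite mulrDr; apply: lerD.
  rewrite -integralVZ//; apply: le_integralV => //; first exact: integrableVZ.
  by move=> y; apply: mixed_log_le.
rewrite -integralVZ//; apply: le_integralV => //; first exact: integrableVZ.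
by move=> y; apply: mixed_log_le.
Qed.

(** If K = 0, the nonnegative integrands [mixed] vanish pointwise, hence B = 0. The Nehari identity
    then gives A = 0, and coercivity forces u = v = 0, which the Nehari set excludes. *)
Lemma Nehari_Kform_gt0 c a b u v : confining c a -> confining c b ->
  Nehari E mu p a b (u, v) -> 0 < K u v.
Proof.
move=> confa confb [/= Hu Hv uv0 dJ].
have reg := H_space_regular confa confb Hu Hv.
rewrite lt0r Kform_ge0 andbT; apply/negP => /eqP K0; apply: uv0.
have /(is_dJ0P reg) := dJ; rewrite K0 mulr0 mul0r => AB.
have [_ _ _ _ [Kuv Kvu _ _]] := reg.
have Kuv0 : 0 <= integralV mu (mixed p u v).
  by apply: integralV_ge0 => // x; rewrite mixed_ge0.
have Kvu0 : 0 <= integralV mu (mixed p v u).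
  by apply: integralV_ge0 => // x; rewrite mixed_ge0.
have mixed0 w z : integrableV mu (mixed p w z) -> integralV mu (mixed p w z) <= 0 ->
    integralV mu (mixed_log p w z) = 0.
  move=> Iwz Iwz0; rewrite (@integralV_ext _ _ _ _ (fun=> 0)) ?integralV0// => x.
  suff : mixed p w z x = 0.
    by rewrite /mixed /mixed_log mulrA => ->; rewrite mul0r.
  apply/le_anti; rewrite mixed_ge0 andbT -(pmulr_lle0 _ (mu_gt0 x)).
  by apply: le_trans Iwz0; apply: term_le_integralV => // y; rewrite mixed_ge0.
have B0 : B u v = 0.
  by rewrite /Bform !mixed0 ?addr0//; move: K0; rewrite /Kform; lra.
have [c0 _ _] := confa.
have mass0 w : 0 <= mass w by apply: integralV_ge0.
have := mass_le_A confa confb Hu Hv.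
have -> : A a b u v = 0 by rewrite -AB B0 subr0.
rewrite pmulr_rle0// => massle.
have [_ Iu _ _] := H_space_integrable confa Hu.
have [_ Iv _ _] := H_space_integrable confb Hv.
have zero w : integrableV mu (fun x => `|w x| `^ p) -> mass w <= 0 -> w = cst 0.
  move=> Iw mass_le0; apply/funext => x; apply/normr0_eq0.
  apply: (@powR_eq0_eq0 _ _ p); apply/le_anti; rewrite normp_ge0 andbT.
  rewrite -(pmulr_lle0 _ (mu_gt0 x)); apply: le_trans mass_le0.
  exact: (@term_le_integralV _ _ _ mu_gt0 (fun x => `|w x| `^ p)).
have -> : u = cst 0.
  by apply: (zero _ Iu); apply: le_trans massle; rewrite lerDl mass0.
have -> // : v = cst 0.
by apply: (zero _ Iv); apply: le_trans massle; rewrite lerDr mass0.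
Qed.

(* With x = A / (c mumin), both |u|^p and |v|^p are bounded by x pointwise, so
   B <= (2/p) ln x K; as A = B + (2/p) K on the Nehari set, this gives
   c mumin x <= (1 + ln x) (2/p) K, which bounds K below and x by O(K^2). *)
Lemma Nehari_bounds c a b u v : confining c a -> confining c b ->
  Nehari E mu p a b (u, v) -> let j := J E mu p a b u v in
  [/\ j = 2 * K u v / p ^+ 2, A a b u v - B u v = p * j, 0 < j, c * mumin <= p * j &
      mass u + mass v <= 4 * p ^+ 2 / (c ^+ 2 * mumin) * j ^+ 2].
Proof.
move=> confa confb uvN; have K0 := Nehari_Kform_gt0 confa confb uvN.
have [/= Hu Hv _ dJ] := uvN.
have reg := H_space_regular confa confb Hu Hv.
have /(is_dJ0P reg) AB := dJ.
have pn0 : p != 0 by exact: lt0r_neq0.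
have jE : J E mu p a b u v = 2 * K u v / p ^+ 2.
  by rewrite (J_regular reg) AB; field.
set j := J E mu p a b u v in jE *.
have j0 : 0 < j by rewrite jE divr_gt0 ?mulr_gt0 ?exprn_gt0.
have ABj : A a b u v - B u v = p * j by rewrite AB jE; field.
have [c0 _ _] := confa.
have [_ Iu _ _] := H_space_integrable confa Hu.
have [_ Iv _ _] := H_space_integrable confb Hv.
have mass0 w : 0 <= mass w by apply: integralV_ge0.
have massu := mass0 u; have massv := mass0 v.
have cA := mass_le_A confa confb Hu Hv.
have mass_gt0 : 0 < mass u + mass v.
  rewrite -(pmulr_rgt0 _ (ltr0Sn R 1)).
  exact: lt_le_trans (Kform_le_mass Iu Iv).
have A0 : 0 < A a b u v by apply: lt_le_trans cA; rewrite mulr_gt0.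
pose x := A a b u v / (c * mumin).
have cmu0 : 0 < c * mumin by rewrite mulr_gt0.
have x0 : 0 < x by rewrite divr_gt0.
have massx : mass u + mass v <= mumin * x.
  have -> : mumin * x = A a b u v / c.
    by rewrite /x; field; rewrite !lt0r_neq0.
  by rewrite ler_pdivlMr// mulrC.
have ux w y : integrableV mu (fun x => `|w x| `^ p) -> mass w <= mass u + mass v ->
    `|w y| `^ p <= x.
  move=> Iw wle; apply: le_trans (sup_bound mumin_gt0 mu_ge y Iw) _.
  by rewrite ler_pdivrMr// mulrC; apply: le_trans massx.
have BK : B u v <= 2 / p * ln x * K u v.
  have [_ _ _ _ [Kuv Kvu Luv Lvu]] := reg.
  apply: (Bform_le Kuv Kvu Luv Lvu x0) => y; apply: ux.
  - exact: Iu.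
  - by rewrite lerDl massv.
  - exact: Iv.
  - by rewrite lerDr massu.
have Kpj : 2 * K u v / p = p * j by rewrite jE; field.
have Ax : c * mumin * x = A a b u v by rewrite /x mulrC divfK ?lt0r_neq0.
have key : c * mumin * x <= (1 + ln x) * (p * j).
  have AE : A a b u v = p * j + B u v by rewrite -ABj subrK.
  rewrite Ax AE mulrDl mul1r lerD2l -Kpj.
  by rewrite (_ : ln x * _ = 2 / p * ln x * K u v)//; ring.
(* Taken with k = c mumin and K = p j. Its second bound, (c mumin)^2 x <= 4 (p j)^2, combined with
   mass <= mumin x, produces the constant 4 p^2 / (c^2 mumin). *)
have [cj cx] := ln_ge_linear cmu0 x0 key (mulr_gt0 p_gt0 j0).
split=> //; apply: le_trans massx _.
rewrite -(@ler_pM2l _ (c ^+ 2 * mumin)) ?mulr_gt0 ?exprn_gt0//.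
have cancel_q (q r i : R) : q != 0 -> q * (r / q * i) = r * i.
  by move=> q0; field.
rewrite cancel_q; last by rewrite lt0r_neq0// mulr_gt0// exprn_gt0.
by rewrite mulrA -[_ * mumin * mumin]mulrA -expr2 -exprMn -[4 * _ * _]mulrA -exprMn.
Qed.

Lemma ground_energy_transfer (M c c' : R) a b a' b' u v :
  confining c a -> confining c b -> confining c' a' -> confining c' b' ->
  (forall x, `|a' x - a x| <= M) -> (forall x, `|b' x - b x| <= M) ->
  Nehari E mu p a b (u, v) ->
  let j := J E mu p a b u v in
  let D := integralV mu
    (fun x => (a' x - a x) * `|u x| `^ p + (b' x - b x) * `|v x| `^ p) in
  (ground_energy E mu p a' b' <= (j * expR (D / (p * j)))%:E)%E /\
  `|D| <= M * (mass u + mass v).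
Proof.
move=> confa confb confa' confb' aM bM uvN j D.
have K0 := Nehari_Kform_gt0 confa confb uvN.
have [jE ABj j0 _ _] := Nehari_bounds confa confb uvN.
rewrite -/j in jE ABj j0.
have [/= Hu Hv _ _] := uvN.
have Hu' := H_space_perturb (confining_ge0 confa') aM confa Hu.
have Hv' := H_space_perturb (confining_ge0 confb') bM confb Hv.
have [Igu Iu Iau _] := H_space_integrable confa Hu.
have [Igv Iv Ibv _] := H_space_integrable confb Hv.
have Ida := integrableV_bounded aM Iu.
have Idb := integrableV_bounded bM Iv.
have DE : D = integralV mu (fun x => (a' x - a x) * `|u x| `^ p) +
  integralV mu (fun x => (b' x - b x) * `|v x| `^ p) by apply: integralVD.
have shift d d' w : integrableV mu (fun x => grad E mu w x `^ p) ->
    integrableV mu (fun x => d x * `|w x| `^ p) ->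
    integrableV mu (fun x => (d' x - d x) * `|w x| `^ p) ->
    energy_form E mu p d' w = energy_form E mu p d w +
    integralV mu (fun x => (d' x - d x) * `|w x| `^ p).
  move=> Ig Id Idd; rewrite -integralVD//; last exact: integrableVD.
  by apply: integralV_ext => x; ring.
have A'E : A a' b' u v = A a b u v + D.
  rewrite /Aform (shift _ _ _ Igu Iau Ida) (shift _ _ _ Igv Ibv Idb) DE.
  exact: addrACA.
split.
  apply: le_trans (ground_energy_le_fiber confa' confb' Hu' Hv' K0) _.
  rewrite -jE lee_fin le_eqVlt; apply/orP; left; apply/eqP; congr (_ * expR _).
  (* With 2 K = p^2 j and A' - B = p j + D, the exponent p (A' - B) / (2 K) - 1 collapses to D / (p
     j). *)
  have KE : 2 * K u v = p ^+ 2 * j by rewrite jE; field; exact: lt0r_neq0.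
  have -> : A a' b' u v - B u v = p * j + D by rewrite A'E -ABj; ring.
  by rewrite KE; field; rewrite !lt0r_neq0.
have small d w : (forall x, `|d x| <= M) -> integrableV mu (fun x => `|w x| `^ p) ->
    `|integralV mu (fun x => d x * `|w x| `^ p)| <= M * mass w.
  move=> dM Iw; have Idw := integrableV_bounded dM Iw.
  have IMw k := integrableVZ k Iw.
  have dMw x : - M * `|w x| `^ p <= d x * `|w x| `^ p <= M * `|w x| `^ p.
    by have := dM x; rewrite ler_norml => /andP[dl dr]; rewrite !ler_wpM2r.
  have le1 : integralV mu (fun x => - M * `|w x| `^ p) <=
      integralV mu (fun x => d x * `|w x| `^ p).
    by apply: (le_integralV mu_gt0 (IMw _) Idw) => x; case/andP: (dMw x).
  have le2 : integralV mu (fun x => d x * `|w x| `^ p) <=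
      integralV mu (fun x => M * `|w x| `^ p).
    by apply: (le_integralV mu_gt0 Idw (IMw _)) => x; case/andP: (dMw x).
  by rewrite !(integralVZ mu_gt0 _ Iw) mulNr in le1 le2; rewrite ler_norml le1 le2.
rewrite DE mulrDr; apply: le_trans (ler_normD _ _) _; apply: lerD.
  exact: small aM Iu.
exact: small bM Iv.
Qed.

End Perturbation.

(** * Scalar estimates for j exp(D / (p j)) *)

Lemma expR_le_quadratic (R : realType) (y : R) : y <= 2^-1 ->
  expR y <= 1 + y + 2 * y ^+ 2.
Proof.
move=> y12; have y1 : 0 < 1 - y by lra.
(* From 1 - y <= exp(-y) follows (1 - y) exp y <= 1, while (1 - y) (1 + y + 2 y^2) >= 1 as soon as y
   <= 1/2. *)
have := expR_ge1Dx (- y); rewrite expRN => le_inv.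
have e0 := expR_gt0 y; have : (1 - y) * expR y <= 1.
  by rewrite -ler_pdivlMr// mul1r.
move=> key; rewrite -(ler_pM2l y1); apply: le_trans key _.
have -> : (1 - y) * (1 + y + 2 * y ^+ 2) = 1 + y ^+ 2 * (1 - 2 * y) by ring.
by rewrite lerDl mulr_ge0 ?sqr_ge0//; lra.
Qed.

Section ScalarBounds.
Context {R : realType}.
Implicit Types p j k D L m : R.

(** The lower bound k on p j serves to free the error constant from j: the natural one is 2 / (p (p
    j)). *)
Lemma mul_expR_le_quadratic p j k D : 0 < p -> 0 < j -> 0 < k -> k <= p * j ->
  `|D| <= k / 2 ->
  j * expR (D / (p * j)) <= j + p^-1 * D + 2 / (p * k) * D ^+ 2.
Proof.
move=> p0 j0 k0 kpj Dk; have pj0 : 0 < p * j by rewrite mulr_gt0.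
have D12 : D / (p * j) <= 2^-1.
  by rewrite ler_pdivrMr//; move: Dk; rewrite ler_norml => /andP[_]; lra.
apply: le_trans (ler_wpM2l (ltW j0) (expR_le_quadratic D12)) _.
have -> : j * (1 + D / (p * j) + 2 * (D / (p * j)) ^+ 2) =
    j + p^-1 * D + 2 / (p * (p * j)) * D ^+ 2.
  by field; rewrite !lt0r_neq0.
rewrite lerD2l ler_wpM2r ?sqr_ge0// ler_wpM2l// lef_pV2 ?posrE ?mulr_gt0//.
by rewrite ler_pM2l.
Qed.

(** The quadratic estimate with k = p j; since 2 |D| <= p j, the quadratic term is at most |D| /
    p. *)
Lemma mul_expR_le_linear p j D : 0 < p -> 0 < j -> 2 * `|D| <= p * j ->
  j * expR (D / (p * j)) <= j + 2 / p * `|D|.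
Proof.
move=> p0 j0 Dpj; have pj0 : 0 < p * j by rewrite mulr_gt0.
have Dk : `|D| <= (p * j) / 2 by lra.
apply: le_trans (mul_expR_le_quadratic p0 j0 pj0 (lexx _) Dk) _.
rewrite -addrA lerD2l.
have -> : 2 / (p * (p * j)) * D ^+ 2 = p^-1 * (2 * `|D| * `|D| / (p * j)).
  by rewrite -(real_normK (num_real D)); field; rewrite !lt0r_neq0.
have -> : 2 / p * `|D| = p^-1 * (`|D| + `|D|) by field; exact: lt0r_neq0.
rewrite -mulrDr ler_wpM2l ?invr_ge0 ?(ltW p0)// lerD ?ler_norm//.
by rewrite ler_pdivrMr// mulrC ler_wpM2l.
Qed.

End ScalarBounds.

Lemma supnorm_ge (R : realType) (V : choiceType) (f : V -> R) x :
  bounded_fun f -> `|f x| <= supnorm f.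
Proof.
move=> [M [_ fM]]; apply: ub_le_sup; last by exists x.
by exists (M + 1) => _ [y _ <-]; apply: fM => //; rewrite ltrDl.
Qed.

Lemma supnorm_ge0 (R : realType) (V : choiceType) (f : V -> R) :
  bounded_fun f -> 0 <= supnorm f.
Proof.
move=> bf; have [[x _]|noV] := pselect (exists x : V, True).
  exact: le_trans (normr_ge0 _) (supnorm_ge x bf).
(* On an empty vertex set [supnorm] takes the default value 0 of [sup] on the empty set. *)
rewrite /supnorm (_ : [set _ | _ in _] = set0) ?sup0//.
by apply/seteqP; split=> // y [x _ _]; apply: noV; exists x.
Qed.

Lemma hypA2'_each (R : realType) (V : choiceType) (mu a b : V -> R) :
  hypA2' mu a b -> hypA2'_single mu a /\ hypA2'_single mu b.
Proof. by move=> [M0 [M00 va vb La Lb]]; split; exists M0. Qed.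

(** * Comparison of two ground-state energies *)

Section TwoPotentials.
Context {R : realType} {V : choiceType} (E : rel V) (mu : V -> R).
Context (mumin p c : R).
Hypotheses (Esym : symmetric E) (Efin : locally_finite_graph E).
Hypotheses (mumin_gt0 : 0 < mumin) (mu_ge : forall x, mumin <= mu x).
Hypotheses (p_gt4 : 4 < p).
Implicit Types (u v a b : V -> R).

Let p_gt0 : 0 < p. Proof. by have := p_gt4; lra. Qed.
Let L := 4 * p ^+ 2 / (c ^+ 2 * mumin).

(** Serves both directions: from (a0, b0) to (a, b) at (u0, v0), and back at (u, v). [D] is a
    variable with a defining equation so that it can be matched with Delta and with -Delta'. *)
Lemma ground_energy_le_quadratic (M : R) a b a' b' u v (D : R) :
  confining mu p c a -> confining mu p c b ->
  confining mu p c a' -> confining mu p c b' ->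
  (forall x, `|a' x - a x| <= M) -> (forall x, `|b' x - b x| <= M) ->
  Nehari E mu p a b (u, v) ->
  D = integralV mu
    (fun x => (a' x - a x) * `|u x| `^ p + (b' x - b x) * `|v x| `^ p) ->
  `|D| <= c * mumin / 2 ->
  (ground_energy E mu p a' b' <= (J E mu p a b u v)%:E +
     (p^-1 * D + 2 / (p * (c * mumin)) * D ^+ 2)%:E)%E.
Proof.
move=> confa confb confa' confb' aM bM uvN DE Dsmall.
have [_ _ j0 cj _] := Nehari_bounds Esym Efin mumin_gt0 mu_ge p_gt4 confa confb uvN.
have [+ _] := ground_energy_transfer Esym Efin mumin_gt0 mu_ge p_gt4
  confa confb confa' confb' aM bM uvN.
rewrite -DE => /le_trans; apply.
have [c0 _ _] := confa; have cmu0 : 0 < c * mumin by rewrite mulr_gt0.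
by rewrite -EFinD lee_fin addrA; apply: mul_expR_le_quadratic.
Qed.

(** The cap [j0] is needed because |D| <= M L j^2: the smallness 2 |D| <= p j amounts to 2 M L j <=
    p, which a small M ensures only for bounded j. *)
Lemma ground_energy_le_linear (M j0 : R) a b a' b' u v :
  confining mu p c a -> confining mu p c b ->
  confining mu p c a' -> confining mu p c b' -> 0 <= M ->
  (forall x, `|a' x - a x| <= M) -> (forall x, `|b' x - b x| <= M) ->
  Nehari E mu p a b (u, v) -> J E mu p a b u v <= j0 -> 2 * (M * (L * j0)) <= p ->
  (ground_energy E mu p a' b' <=
    (J E mu p a b u v)%:E + (2 / p * L * j0 ^+ 2 * M)%:E)%E.
Proof.
move=> confa confb confa' confb' M0 aM bM uvN jj0 Msmall.
have [_ _ j_gt0 _ massL] :=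
  Nehari_bounds Esym Efin mumin_gt0 mu_ge p_gt4 confa confb uvN.
have [+ Dmass] := ground_energy_transfer Esym Efin mumin_gt0 mu_ge p_gt4
  confa confb confa' confb' aM bM uvN.
move: Dmass.
set D := integralV mu _; set j := J E mu p a b u v in j_gt0 massL jj0 * => Dmass.
move=> /le_trans; apply.
have [c0 _ _] := confa.
have L0 : 0 <= L by rewrite divr_ge0 ?mulr_ge0 ?sqr_ge0 ?ltW.
have j_ge0 := ltW j_gt0.
have DM : `|D| <= M * (L * j ^+ 2).
  by apply: le_trans Dmass _; rewrite ler_wpM2l.
have D2 : 2 * `|D| <= p * j.
  apply: (@le_trans _ _ (2 * (M * (L * j ^+ 2)))); first by rewrite ler_pM2l.
  have -> : 2 * (M * (L * j ^+ 2)) = 2 * (M * (L * j)) * j by ring.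
  rewrite ler_wpM2r//; apply: le_trans Msmall.
  by rewrite ler_pM2l// !ler_wpM2l.
rewrite -EFinD lee_fin; apply: le_trans (mul_expR_le_linear p_gt0 j_gt0 D2) _.
have -> : 2 / p * L * j0 ^+ 2 * M = 2 / p * (M * (L * j0 ^+ 2)) by ring.
rewrite lerD2l; apply: ler_wpM2l; first by rewrite divr_ge0// ltW.
apply: le_trans DM _; apply: ler_wpM2l => //; apply: ler_wpM2l => //.
by rewrite ler_pXn2r ?nnegrE// (le_trans j_ge0).
Qed.

End TwoPotentials.

(* The constant l is chosen before the potentials a0, b0: on the given weighted
   graph it depends only on u0, v0, p and V0. *)
Theorem theorem1p4 (R : realType) (V : choiceType) (E : rel V) (mu : V -> R)
    (mumin p V0 : R) (u0 v0 : V -> R)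
    (Esym : symmetric E) (Econn : graph_connected E)
    (Efin : locally_finite_graph E)
    (mumin_gt0 : 0 < mumin) (mu_ge : forall x, mumin <= mu x)
    (p_gt4 : 4 < p) (V0_gt0 : 0 < V0) :
  exists2 l : R, 0 < l &
  forall a0 b0 : V -> R,
    hypA1 V0 a0 b0 -> hypA2' mu a0 b0 ->
    ground_state E mu p a0 b0 u0 v0 ->
  exists2 eps0 : R, 0 < eps0 &
  exists eta C : R, [/\ 0 < eta, 0 < C &
  forall da1 db1 : V -> R,
    bounded_fun da1 -> bounded_fun db1 ->
    supnorm da1 <= eps0 -> supnorm db1 <= eps0 ->
    let a := fun x => a0 x + da1 x in
    let b := fun x => b0 x + db1 x in
    let d0 := ground_energy E mu p a0 b0 in
    let d := ground_energy E mu p a b in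
    let Delta :=
      integralV mu (fun x => da1 x * `|u0 x| `^ p + db1 x * `|v0 x| `^ p) in
    (`|d - d0| <= (l * Num.max (supnorm da1) (supnorm db1))%:E)%E
    /\ (`|Delta| <= eta ->
          (d <= d0 + (p^-1 * Delta + C * `|Delta| ^+ 2)%:E)%E
          /\ forall u v : V -> R, ground_state E mu p a b u v ->
               let Delta' :=
                 integralV mu
                   (fun x => da1 x * `|u x| `^ p + db1 x * `|v x| `^ p) in
               `|Delta'| <= eta ->
               (d0 + (p^-1 * Delta' - C * `|Delta'| ^+ 2)%:E <= d)%E)].
Proof.
have p_gt0 : 0 < p by lra.
(* A perturbation of size at most V0 / 2 keeps the potentials above V0 / 2, so one constant c serves
   both pairs. *)
pose c := V0 / 2; have c_gt0 : 0 < c by rewrite divr_gt0.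
(* This is the energy of (u0, v0), written through K, which involves no potential; hence l can be
   fixed before [a0] and [b0]. *)
pose j0 := 2 * Kform mu p u0 v0 / p ^+ 2.
pose L := 4 * p ^+ 2 / (c ^+ 2 * mumin).
have L_gt0 : 0 < L by rewrite divr_gt0 ?mulr_gt0 ?exprn_gt0.
have linear_ge0 : 0 <= 2 / p * L * j0 ^+ 2.
  by rewrite mulr_ge0 ?sqr_ge0// mulr_ge0 ?(ltW L_gt0)// divr_ge0// ltW.
exists (1 + 2 / p * L * j0 ^+ 2); first by rewrite ltr_pwDl.
move=> a0 b0 [a0V0 b0V0] /hypA2'_each[A2a0 A2b0] [uvN0 J0].
have cV0 : c < V0 by rewrite /c; lra.
have conf0 d : (forall x, V0 <= d x) -> hypA2'_single mu d -> confining mu p c d.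
  move=> dV0; apply: (confining_hypA2' mumin_gt0 mu_ge p_gt4 c_gt0) => x.
  exact: le_trans (ltW cV0) (dV0 x).
have confa0 := conf0 _ a0V0 A2a0; have confb0 := conf0 _ b0V0 A2b0.
have [jE _ j_gt0 _ _] :=
  Nehari_bounds Esym Efin mumin_gt0 mu_ge p_gt4 confa0 confb0 uvN0.
rewrite -/j0 in jE; rewrite jE in j_gt0.
have Lj_gt0 : 0 < 2 * (L * j0) := mulr_gt0 (ltr0Sn R 1) (mulr_gt0 L_gt0 j_gt0).
(* The first bound keeps the perturbed potentials above c, the second gives 2 m L j0 <= p. *)
exists (Num.min c (p / (2 * (L * j0)))).
  by rewrite lt_min c_gt0 divr_gt0.
(* Both constants come from the quadratic estimate with k = c mumin, the uniform lower bound of p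
   j. *)
exists (c * mumin / 2), (2 / (p * (c * mumin))).
have cmu_gt0 : 0 < c * mumin := mulr_gt0 c_gt0 mumin_gt0.
split; [exact: divr_gt0|by rewrite divr_gt0// mulr_gt0|].
move=> da db bda bdb da_eps db_eps a b d0 d Delta.
set m := Num.max _ _.
have dam x : `|da x| <= m by rewrite le_max (supnorm_ge x bda).
have dbm x : `|db x| <= m by rewrite le_max (supnorm_ge x bdb) orbT.
have m_eps : m <= Num.min c (p / (2 * (L * j0))) by rewrite ge_max da_eps.
have conf' d1 dd : (forall x, V0 <= d1 x) -> (forall x, `|dd x| <= m) ->
    confining mu p c d1 -> confining mu p c (fun x => d1 x + dd x).
  move=> d1V0 ddm; apply: (confining_perturb (M := m)) => // x; last first.
    by rewrite addrC addKr.
  have := ddm x; have := d1V0 x; move: m_eps; rewrite le_min => /andP[mc _].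
  by rewrite ler_norml /c in mc * => ? /andP[? _]; lra.
have confa := conf' _ _ a0V0 dam confa0; have confb := conf' _ _ b0V0 dbm confb0.
have aa0 x : `|a x - a0 x| <= m by rewrite /a addrC addKr.
have bb0 x : `|b x - b0 x| <= m by rewrite /b addrC addKr.
have a0a x : `|a0 x - a x| <= m by rewrite distrC.
have b0b x : `|b0 x - b x| <= m by rewrite distrC.
have m_small : 2 * (m * (L * j0)) <= p.
  move: m_eps; rewrite le_min => /andP[_].
  by rewrite ler_pdivlMr// mulrCA.
have d0E : d0 = j0%:E by rewrite /d0 -J0 jE.
have m_ge0 : 0 <= m by rewrite le_max supnorm_ge0.
split.
  have upper : (d <= (j0 + 2 / p * L * j0 ^+ 2 * m)%:E)%E.
    have := ground_energy_le_linear (j0 := j0) Esym Efin mumin_gt0 mu_ge p_gt4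
      confa0 confb0 confa confb m_ge0 aa0 bb0 uvN0.
    by rewrite jE => /(_ (lexx _) m_small); rewrite -EFinD.
  have lower : ((j0 - 2 / p * L * j0 ^+ 2 * m)%:E <= d)%E.
    apply/ereal_infP => _ [[u v] uvN <-]; rewrite lee_fin lerBlDr.
    (* A perturbed point of energy above [j0] satisfies the bound trivially; one below is
       transferred back to (a0, b0), with the cap [j0] available. *)
    have [jj0|/ltW j0j] := leP (J E mu p a b u v) j0; last first.
      by apply: (le_trans j0j); rewrite lerDl mulr_ge0.
    have := ground_energy_le_linear Esym Efin mumin_gt0 mu_ge p_gt4
      confa confb confa0 confb0 m_ge0 a0a b0b uvN jj0 m_small.
    by rewrite -/d0 d0E -EFinD lee_fin.
  (* The two real bounds exclude infinite values of [d]. *)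
  move: upper lower; rewrite d0E; case: (d) => [r| |] //=.
  rewrite !lee_fin ler_distl => rup rlow; rewrite mulrDl mul1r.
  by apply/andP; split; lra.
move=> Delta_small; split.
  have DE : Delta = integralV mu (fun x =>
      (a x - a0 x) * `|u0 x| `^ p + (b x - b0 x) * `|v0 x| `^ p).
    by apply: integralV_ext => x; rewrite /a /b; ring.
  have := ground_energy_le_quadratic Esym Efin mumin_gt0 mu_ge p_gt4
    confa0 confb0 confa confb aa0 bb0 uvN0 DE Delta_small.
  by rewrite J0 real_normK ?num_real.
move=> u v [uvN Jd] Delta' Delta'_small.
have [/= Hu Hv _ _] := uvN.
have [_ Iu _ _] := H_space_integrable Esym Efin mumin_gt0 mu_ge p_gt4 confa Hu.
have [_ Iv _ _] := H_space_integrable Esym Efin mumin_gt0 mu_ge p_gt4 confb Hv.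
have ID := integrableVD (integrableV_bounded dam Iu) (integrableV_bounded dbm Iv).
have mu_gt0 x : 0 < mu x by exact: lt_le_trans (mu_ge x).
(* Going back from (a, b) reverses the sign: d0 <= d - Delta' / p + C Delta'^2, which rearranges to
   the claim. *)
have DE : - Delta' = integralV mu (fun x =>
    (a0 x - a x) * `|u x| `^ p + (b0 x - b x) * `|v x| `^ p).
  rewrite -(integralVN mu_gt0 ID).
  by apply: integralV_ext => x; rewrite /a /b; ring.
have D'small : `|- Delta'| <= c * mumin / 2 by rewrite normrN.
have := ground_energy_le_quadratic Esym Efin mumin_gt0 mu_ge p_gt4
  confa confb confa0 confb0 a0a b0b uvN DE D'small.
rewrite -/d0 d0E /d -Jd -!EFinD !lee_fin sqrrN mulrN real_normK ?num_real//.
by lra.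
Qed.
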